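(* Let $k\geq 1$ be an integer. If a graph $H$ is KNRS and regular, then its $2k$-subdivision $H^{(2k)}$ is also KNRS.
   Context: All graphs are finite and simple. For graphs $H,G$, the homomorphism density $t(H,G)$ is the probability that a uniformly random map $f:V(H)\to V(G)$ satisfies $f(u)f(v)\in E(G)$ for every $uv\in E(H)$. For an integer $s\geq1$, the $s$-subdivision $H^{(s)}$ of $H$ is obtained by replacing each edge $uv$ of $H$ by a path of length $s+1$ between $u$ and $v$, the paths being internally vertex-disjoint. An $n$-vertex graph $G$ is $(\rho,d)$-dense if every vertex subset $X$ with $|X|\geq\rho n$ spans at least $\frac d2|X|^2$ edges. A graph $H$ is KNRS if for all reals $d,\varepsilon>0$ there is $\rho=\rho(d,H,\varepsilon)>0$ such that $t(H,G)\geq(1-\varepsilon)d^{|E(H)|}$ for every sufficiently large $(\rho,d)$-dense graph $G$. *)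

(* Defs.v *)
From HB Require Import structures.
From mathcomp Require Import all_boot all_order all_algebra.
From mathcomp Require Import reals.

Set Implicit Arguments.
Unset Strict Implicit.
Unset Printing Implicit Defensive.

Import Order.TTheory GRing.Theory Num.Theory.
Local Open Scope ring_scope.

Record sgraph := SGraph {
  vertex :> finType;
  adj : rel vertex;
  adj_sym : symmetric adj;
  adj_irrefl : irreflexive adj }.

Definition edges (G : sgraph) : {set {set G}} :=
  [set [set p.1; p.2] | p : G * G & adj p.1 p.2].

Definition edges_in (G : sgraph) (X : {set G}) : {set {set G}} :=
  [set e in edges G | e \subset X].

Definition is_hom (H G : sgraph) (f : {ffun H -> G}) : bool :=
  [forall u, forall v, adj u v ==> adj (f u) (f v)].

Definition hom_density (R : realType) (H G : sgraph) : R :=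
  #|[set f : {ffun H -> G} | is_hom f]|%:R / #|{: {ffun H -> G}}|%:R.

Definition regular (G : sgraph) : Prop :=
  exists r : nat, forall v : G, #|[set w | adj v w]| = r.

Definition dense (R : realType) (rho d : R) (G : sgraph) : Prop :=
  forall X : {set G}, rho * #|G|%:R <= #|X|%:R ->
    d / 2 * #|X|%:R ^+ 2 <= #|edges_in X|%:R.

Definition KNRS (R : realType) (H : sgraph) : Prop :=
  forall d eps : R, 0 < d -> 0 < eps ->
  exists2 rho : R, 0 < rho &
  exists N : nat, forall G : sgraph, (N <= #|G|)%N -> dense rho d G ->
    (1 - eps) * d ^+ #|edges H| <= hom_density R H G.

Section Subdivision.
Variables (s : nat) (H : sgraph).

(* Each edge of H is listed once, oriented by the enumeration of its vertices;
   the orientation only serves to number the inner vertices of its path. *)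
Definition oedge : finType :=
  {p : H * H | adj p.1 p.2 && (enum_rank p.1 < enum_rank p.2)%N}.

Definition subdiv_vertex : finType := (H + oedge * 'I_s)%type.

(* The j-th vertex, 0 <= j <= s.+1, of the path of length s.+1 that replaces
   the edge p; the end vertices are those of p. *)
Definition subdiv_path (p : oedge) (j : nat) : subdiv_vertex :=
  if j is i.+1 then
    if insub i is Some i' then inr (p, i') else inl (val p).2
  else inl (val p).1.

Definition subdiv_adj : rel subdiv_vertex := fun x y =>
  [exists p : oedge, exists j : 'I_s.+1,
    ((x == subdiv_path p j) && (y == subdiv_path p j.+1)) ||
    ((y == subdiv_path p j) && (x == subdiv_path p j.+1))].

Lemma subdiv_adj_sym : symmetric subdiv_adj.
Proof.
by move=> x y; apply: eq_existsb => p; apply: eq_existsb => j; rewrite orbC.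
Qed.

Lemma subdiv_path_neq (p : oedge) (j : 'I_s.+1) :
  subdiv_path p j != subdiv_path p j.+1.
Proof.
case: j => [[|j] /=] js.
  case: insubP => [//|_]; apply/eqP => -[].
  by case: p => -[u v] /= /andP[_ uv] euv; rewrite euv ltnn in uv.
rewrite insubT; case: insubP => [i _ ei|_ //].
by apply/eqP => -[eij]; move: ei; rewrite -eij /= => /n_Sn.
Qed.

Lemma subdiv_adj_irrefl : irreflexive subdiv_adj.
Proof.
move=> x; apply/negbTE/existsP => -[p /existsP[j]].
by rewrite orbb => /andP[/eqP-> ]; apply/negP/subdiv_path_neq.
Qed.

Definition subdivision : sgraph := SGraph subdiv_adj_sym subdiv_adj_irrefl.

End Subdivision.

(* Main.v *)
(** Let [w x] be the number of walks of length [k] from [x] in [G]. Splitting a path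
    of length [2k+1] at its middle edge, the number of homomorphisms from the
    [2k]-subdivision of an [r]-regular graph [H] to [G] is the sum over maps [x]
    from [H] to [G] of [\prod_u w (x u) ^ r \prod_(uv) K (x u) (x v)], where
    [K x y] is the probability that the endpoints of independent random [k]-walks
    from [x] and [y] are adjacent. Testing the local density of [G] on
    the endpoint distribution of a random [k]-walk shows that [K] is again locally
    dense for the vertex weights [w ^ r], so the KNRS property of [H] bounds the sum
    below by [d ^ e(H) * (\sum_x w x ^ r) ^ v(H)], up to small errors, and
    [\sum_x w x >= d ^ k * n ^ (k+1)] and the power mean inequality conclude. The
    KNRS property only speaks about simple graphs; it is transferred to the weighted
    kernel [K] through a large simple graph whose adjacency samples the walks
    independently for different pairs of vertices. *)

Require Import Defs.
From mathcomp Require Import all_boot all_order all_algebra.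
From mathcomp Require Import reals lra ring zify.

Set Implicit Arguments.
Unset Strict Implicit.
Unset Printing Implicit Defensive.
Import Order.TTheory GRing.Theory Num.Theory.
Local Open Scope ring_scope.

(** * Local density tested on functions *)

(** The bilinear form of the adjacency matrix. It runs over ordered pairs, so on the indicator of a
    set every edge inside counts twice. *)
Definition edge_form (R : realType) (G : sgraph) (f g : G -> R) : R :=
  \sum_s \sum_t (adj s t)%:R * (f s * g t).

Lemma set2_eq (T : finType) (a b c d : T) :
  [set a; b] = [set c; d] -> (a = c /\ b = d) \/ (a = d /\ b = c).
Proof.
move=> E.
have [/set2P a_cd /set2P b_cd] : a \in [set c; d] /\ b \in [set c; d].
  by rewrite -E set21 set22.
have [/set2P c_ab /set2P d_ab] : c \in [set a; b] /\ d \in [set a; b].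
  by rewrite E set21 set22.
by intuition congruence.
Qed.

Lemma card_adj_in (G : sgraph) (X : {set G}) :
  #|[set p : G * G | [&& adj p.1 p.2, p.1 \in X & p.2 \in X]]|
  = (2 * #|edges_in X|)%N.
Proof.
set D := finset _.
rewrite -sum1_card.
rewrite (partition_big (fun p => [set p.1; p.2]) (mem (edges_in X))) /=; last first.
  move=> p; rewrite !inE => /and3P[a x y]; apply/andP; split.
    by apply/imsetP; exists p; rewrite ?inE.
  by rewrite subUset !sub1set x y.
rewrite mulnC -sum_nat_const; apply: eq_bigr => e; rewrite !inE => /andP[].
case/imsetP=> -[s t] /=; rewrite inE /= => st -> {e}.
rewrite subUset !sub1set => /andP[sX tX].
have nst : (s, t) != (t, s).
  by apply: contraTneq st => -[-> _]; rewrite adj_irrefl.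
rewrite sum1_card -(_ : #|[set (s, t); (t, s)]| = 2%N); last by rewrite cards2 nst.
apply: eq_card => -[s' t']; rewrite !inE /=.
apply/andP/orP => [[_ /eqP/set2_eq /= [] [-> ->]]|[] /eqP[-> ->]].
- by left.
- by right.
- by rewrite inE /= st sX tX.
- by rewrite inE /= adj_sym st sX tX setUC.
Qed.

Lemma edges_in_setT (G : sgraph) : edges_in [set: G] = edges G.
Proof. by apply/setP => e; rewrite inE subsetT andbT. Qed.

Lemma edge_form_indicator (R : realType) (G : sgraph) (X : {set G}) :
  edge_form (fun s => (s \in X)%:R : R) (fun s => (s \in X)%:R)
  = 2 * #|edges_in X|%:R.
Proof.
rewrite -natrM -card_adj_in -sum1_card natr_sum big_mkcond /edge_form pair_bigA /=.
apply: eq_bigr => -[s t] _ /=; rewrite !inE /= -!natrM !mulnb.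
by case: ifP.
Qed.

(** Used with [z] the indicator of a vertex: the quadratic term then vanishes for lack of loops, and
    the form is affine in that coordinate. *)
Lemma edge_form_line (R : realType) (G : sgraph) (y z : G -> R) (c : R) :
  edge_form (fun s => y s + c * z s) (fun s => y s + c * z s)
  = edge_form y y + c * (edge_form y z + edge_form z y) + c ^+ 2 * edge_form z z.
Proof.
rewrite /edge_form !(mulrDr, mulr_sumr) -!big_split /=; apply: eq_bigr => s _.
rewrite !mulr_sumr -!big_split /=; apply: eq_bigr => t _; ring.
Qed.

(* [edge_form y y - d * (\sum_s y s) ^+ 2] is concave in each coordinate, because
   the graph has no loops, so on the cube it is smallest at a 0/1 point. *)
Lemma dense_edge_form (R : realType) (rho d : R) (G : sgraph) (y : G -> R) :
  0 <= d -> dense rho d G -> (forall s, 0 <= y s <= 1) ->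
  d * ((\sum_s y s) ^+ 2 - (rho * #|G|%:R) ^+ 2) <= edge_form y y.
Proof.
move=> d0 dG.
(* [l] lists the coordinates still allowed to be fractional; each induction step compares one of
   them with its values at 0 and 1. *)
suff main (l : seq G) : forall y : G -> R, (forall s, 0 <= y s <= 1) ->
    (forall s, s \notin l -> y s = (y s == 1)%:R) ->
    d * ((\sum_s y s) ^+ 2 - (rho * #|G|%:R) ^+ 2) <= edge_form y y.
  by move=> y01; apply: (main (enum G)) => // s; rewrite mem_enum.
elim: l => [|t l IHl] {}y y01 yl.
  pose X := [set s | y s == 1].
  have yX s : y s = (s \in X)%:R by rewrite inE; apply: yl.
  have -> : \sum_s y s = #|X|%:R.
    rewrite -sum1_card natr_sum [RHS]big_mkcond /=.
    by apply: eq_bigr => s _; rewrite yX; case: (s \in X).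
  have -> : edge_form y y = 2 * #|edges_in X|%:R.
    rewrite -edge_form_indicator; apply: eq_bigr => s _; apply: eq_bigr => u _.
    by rewrite !yX.
  have [le|lt] := leP (rho * #|G|%:R) #|X|%:R.
    have := dG _ le; have := sqr_ge0 (rho * #|G|%:R); nra.
  (* Below the size threshold of [dense] the left-hand side is at most 0. *)
  apply: (@le_trans _ _ 0); last by rewrite mulr_ge0.
  rewrite mulr_ge0_le0 // subr_le0 lerXn2r ?nnegrE ?ler0n ?ltW //.
  exact: le_lt_trans lt.
pose z s : R := (s == t)%:R.
pose y0 s := if s == t then 0 else y s.
have sz : \sum_s z s = 1.
  by rewrite (bigD1 t) //= /z eqxx big1 ?addr0 // => s /negbTE->.
have zz : edge_form z z = 0.
  rewrite /edge_form big1 // => s _; rewrite big1 // => u _; rewrite /z.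
  case: eqP => [->|]; last by rewrite mul0r mulr0.
  by case: eqP => [->|]; rewrite ?adj_irrefl ?mul0r // !mulr0.
pose Y c s := y0 s + c * z s.
have Yt c : Y c t = c by rewrite /Y /y0 /z eqxx mulr1 add0r.
have Yn c s : s != t -> Y c s = y s.
  by move=> /negbTE st; rewrite /Y /y0 /z st mulr0 addr0.
have bound c : c = 0 \/ c = 1 ->
    d * ((\sum_s Y c s) ^+ 2 - (rho * #|G|%:R) ^+ 2) <= edge_form (Y c) (Y c).
  move=> c01; apply: IHl => s; have [->|st] := eqVneq s t; rewrite ?Yt ?Yn //.
  - by case: c01 => ->; rewrite ?lexx ler01.
  - by case: c01 => -> _; rewrite ?eqxx // eq_sym oner_eq0.
  - by move=> sl; apply: yl; rewrite inE negb_or st.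
have EY c : edge_form (Y c) (Y c) = edge_form y0 y0
   + c * (edge_form y0 z + edge_form z y0).
  by rewrite edge_form_line zz mulr0 addr0.
have SY c : \sum_s Y c s = \sum_s y0 s + c.
  by rewrite big_split /= -mulr_sumr sz mulr1.
have yY s : y s = Y (y t) s by have [->|st] := eqVneq s t; rewrite ?Yt ?Yn.
have -> : \sum_s y s = \sum_s Y (y t) s by apply: eq_bigr => s _.
have -> : edge_form y y = edge_form (Y (y t)) (Y (y t)).
  by apply: eq_bigr => s _; apply: eq_bigr => u _; rewrite -!yY.
have := bound 0 (or_introl erefl); have := bound 1 (or_intror erefl).
rewrite !EY !SY; move: (y01 t) => /andP[].
move: (y t) (\sum_s y0 s) (edge_form y0 y0) (_ + edge_form z y0) (rho * _) => c S E L r.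
move=> c0 c1 b1 b0.
(* Averaging the two bounds with weights [1 - c] and [c] preserves the affine right-hand side and
   turns the square into [(S + c) ^+ 2 + c * (1 - c)], whose excess is nonnegative. *)
have b0' := ler_wpM2l (_ : 0 <= 1 - c) b0.
have b1' := ler_wpM2l c0 b1.
have dc : 0 <= d * (c * (1 - c)) by rewrite !mulr_ge0 // subr_ge0.
have := b0' ltac:(lra); lra.
Qed.

Lemma dense_edge_form_scaled (R : realType) (rho d M : R) (G : sgraph) (y : G -> R) :
  0 <= d -> 0 < M -> dense rho d G -> (forall s, 0 <= y s <= M) ->
  d * ((\sum_s y s) ^+ 2 - (rho * #|G|%:R * M) ^+ 2) <= edge_form y y.
Proof.
move=> d0 M0 dG yM; pose z s := y s / M.
have z01 s : 0 <= z s <= 1.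
  have /andP[y0 y1] := yM s; apply/andP; split; first exact: divr_ge0 y0 (ltW M0).
  by rewrite ler_pdivrMr ?mul1r.
have yz s : y s = M * z s by rewrite /z mulrC divfK ?gt_eqF.
have -> : \sum_s y s = M * \sum_s z s by rewrite mulr_sumr; apply: eq_bigr.
have -> : edge_form y y = M ^+ 2 * edge_form z z.
  rewrite /edge_form mulr_sumr; apply: eq_bigr => s _; rewrite mulr_sumr.
  by apply: eq_bigr => t _; rewrite !yz; ring.
have := ler_wpM2l (sqr_ge0 M) (dense_edge_form d0 dG z01); nra.
Qed.

(** * Walks *)

Fixpoint walks (G : sgraph) (j : nat) (x y : G) : nat :=
  if j is i.+1 then (\sum_z adj x z * walks i z y)%N else (x == y).

Definition nwalks (G : sgraph) (j : nat) (x : G) : nat := (\sum_y walks j x y)%N.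

Section Walks.
Variable G : sgraph.
Implicit Types x y z : G.

Lemma walks_add i j x y :
  walks (i + j) x y = (\sum_z walks i x z * walks j z y)%N.
Proof.
elim: i x => [|i IHi] x /=.
  rewrite (bigD1 x) //= eqxx mul1n big1 ?addn0 // => z.
  by rewrite eq_sym => /negbTE->.
transitivity (\sum_z \sum_t adj x z * (walks i z t * walks j t y))%N.
  by apply: eq_bigr => z _; rewrite IHi big_distrr.
rewrite exchange_big; apply: eq_bigr => t _; rewrite big_distrl /=.
by apply: eq_bigr => z _; rewrite mulnA.
Qed.

Lemma walksS j x y : walks j.+1 x y = (\sum_z adj x z * walks j z y)%N.
Proof. by []. Qed.

Lemma walks1 x y : walks 1 x y = adj x y.
Proof.
rewrite /= (bigD1 y) //= eqxx muln1 big1 ?addn0 // => z /negbTE->.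
by rewrite muln0.
Qed.

Lemma walks_sym j x y : walks j x y = walks j y x.
Proof.
elim: j x y => [|j IHj] x y; first by rewrite /= eq_sym.
rewrite -[in RHS]addn1 walks_add; apply: eq_bigr => z _.
by rewrite walks1 adj_sym IHj mulnC.
Qed.

Lemma nwalksS j x : nwalks j.+1 x = (\sum_z adj x z * nwalks j z)%N.
Proof.
by rewrite /nwalks /= exchange_big; apply: eq_bigr => z _; rewrite big_distrr.
Qed.

Lemma nwalks_le j x : (nwalks j x <= #|G| ^ j)%N.
Proof.
elim: j x => [|j IHj] x.
  rewrite /nwalks /= (bigD1 x) //= eqxx big1 // => z.
  by rewrite eq_sym => /negbTE->.
rewrite nwalksS expnS -sum_nat_const; apply: leq_sum => z _.
by case: adj; rewrite ?mul1n ?IHj.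
Qed.

(** A walk is cut after [i] steps and its first piece is read backwards from the cut vertex. *)
Lemma sum_nwalks_add i j :
  (\sum_(x : G) nwalks (i + j) x = \sum_(x : G) nwalks i x * nwalks j x)%N.
Proof.
transitivity (\sum_(x : G) \sum_z \sum_y walks i x z * walks j z y)%N.
  apply: eq_bigr => x _; rewrite exchange_big; apply: eq_bigr => z _.
  exact: walks_add.
rewrite exchange_big; apply: eq_bigr => z _; rewrite big_distrlr /=.
by apply: eq_bigr => x _; apply: eq_bigr => y _; rewrite [walks i x z]walks_sym.
Qed.

Lemma edge_form_nwalks (R : realType) j :
  edge_form (fun x : G => (nwalks j x)%:R : R) (fun x => (nwalks j x)%:R)
  = (\sum_(x : G) nwalks (j + j).+1 x)%:R.
Proof.
rewrite -addnS sum_nwalks_add natr_sum; apply: eq_bigr => x _.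
rewrite nwalksS natrM natr_sum mulr_sumr; apply: eq_bigr => z _.
by rewrite natrM; ring.
Qed.

End Walks.

(** * Power means and the number of walks *)

Lemma exprn_tangent_le (R : realType) (c w : R) (r : nat) : 0 <= c -> 0 <= w ->
  c ^+ r.+1 + r.+1%:R * c ^+ r * (w - c) <= w ^+ r.+1.
Proof.
move=> c0 w0; elim: r => [|r IHr]; first by rewrite expr0 !expr1; lra.
rewrite [w ^+ r.+2]exprS; apply: le_trans (ler_wpM2l w0 IHr); rewrite -subr_ge0.
have -> : w * (c ^+ r.+1 + r.+1%:R * c ^+ r * (w - c))
  - (c ^+ r.+2 + r.+2%:R * c ^+ r.+1 * (w - c))
  = r.+1%:R * c ^+ r * (w - c) ^+ 2.
  by rewrite -[r.+2%:R]natr1 !exprS; ring.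
by apply: mulr_ge0; rewrite ?sqr_ge0 // mulr_ge0 ?exprn_ge0.
Qed.

(** Sum the tangent inequalities at [c]: the linear terms add up to a nonnegative number, since the
    mean of [w] is at least [c]. *)
Lemma power_mean (R : realType) (I : finType) (w : I -> R) (c : R) (r : nat) :
  0 <= c -> (forall i, 0 <= w i) -> #|I|%:R * c <= \sum_i w i ->
  #|I|%:R * c ^+ r <= \sum_i w i ^+ r.
Proof.
move=> c0 w0 cw; case: r => [|r].
  by under eq_bigr do rewrite expr0; rewrite sumr_const expr0 mulr1.
apply: le_trans (ler_sum _ (fun i _ => exprn_tangent_le r c0 (w0 i))).
rewrite big_split /= -mulr_sumr sumrB !sumr_const -[c *+ _]mulr_natl.
rewrite -[c ^+ r.+1 *+ _]mulr_natl lerDl !mulr_ge0 ?exprn_ge0 //.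
by rewrite subr_ge0.
Qed.

(** Induction on [k] by halving. For [k = 2j] the walk is cut at its midpoint and the quadratic mean
    inequality applies; for [k = 2j + 1] it is cut at its middle edge and local density is tested on
    [nwalks j], which is at most [#|G| ^ j]. The factor [a] pays for the error term. *)
Lemma dense_nwalks (R : realType) (rho d a : R) (G : sgraph) (k : nat) :
  0 < d <= 1 -> 0 < a <= 1 -> 0 <= rho -> (0 < #|G|)%N -> dense rho d G ->
  rho ^+ 2 <= (1 - a) * (a * d) ^+ (k + k) ->
  #|G|%:R * (a * d * #|G|%:R) ^+ k <= (\sum_(x : G) nwalks k x)%:R.
Proof.
move=> /andP[d0 d1] /andP[a0 a1] r0 G0 dG.
have ad0 : 0 < a * d by rewrite mulr_gt0.
have ad1 : a * d <= 1 by rewrite mulr_ile1 // ltW.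
have n0 : 0 < #|G|%:R :> R by rewrite ltr0n.
have [m] := ubnP k; elim: m k => // m IHm k km rk.
case: (posnP k) => [->|k0].
  rewrite expr0 mulr1 ler_nat -sum1_card leq_sum // => x _.
  by rewrite /nwalks (bigD1 x) //= eqxx.
pose j := k./2.
have jk : (j < k)%N by rewrite /j -divn2 ltn_Pdiv.
have IHj : #|G|%:R * (a * d * #|G|%:R) ^+ j <= (\sum_(x : G) nwalks j x)%:R.
  apply: IHm; first exact: leq_trans jk km.
  apply: le_trans rk _; rewrite ler_wpM2l ?subr_ge0 //.
  by rewrite ler_wiXn2l ?(ltW ad0) // leq_add ?(ltnW jk).
have kE := odd_double_half k; rewrite -/j -addnn in kE.
case: (odd k) kE => /= [|] kE.
  rewrite -kE add1n -edge_form_nwalks.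
  have M0 : 0 < (#|G|%:R : R) ^+ j by rewrite exprn_gt0.
  have yM (x : G) : 0 <= ((nwalks j x)%:R : R) <= #|G|%:R ^+ j.
    by rewrite ler0n -natrX ler_nat nwalks_le.
  apply: le_trans (dense_edge_form_scaled (ltW d0) M0 dG yM).
  rewrite -natr_sum.
  have IH2 : (#|G|%:R * (a * d * #|G|%:R) ^+ j) ^+ 2
      <= ((\sum_(x : G) nwalks j x)%:R : R) ^+ 2.
    by rewrite lerXn2r ?nnegrE // mulr_ge0 ?exprn_ge0 // mulr_ge0 // ltW.
  apply: (@le_trans _ _ (d * ((#|G|%:R * (a * d * #|G|%:R) ^+ j) ^+ 2
       - (rho * #|G|%:R * #|G|%:R ^+ j) ^+ 2))); last first.
    by rewrite ler_wpM2l ?(ltW d0) // lerB.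
  have rj : rho ^+ 2 <= (1 - a) * (a * d) ^+ (j + j).
    apply: le_trans rk _; rewrite ler_wpM2l ?subr_ge0 //.
    by rewrite ler_wiXn2l ?(ltW ad0) // leq_add ?(ltnW jk).
  (* Scaled by this factor, the bound on [rho] says that the error term is at most [1 - a] times the
     main term. *)
  have N0 : 0 <= d * (#|G|%:R ^+ j.+1) ^+ 2 by rewrite mulr_ge0 ?sqr_ge0 ?ltW.
  have := ler_wpM2l N0 rj.
  rewrite -subr_ge0 => h; rewrite -subr_ge0; apply: le_trans h _.
  by rewrite le_eqVlt; apply/orP; left; apply/eqP; rewrite !exprS !exprMn !exprD; ring.
rewrite -kE add0n sum_nwalks_add exprD -expr2 natr_sum.
under eq_bigr do rewrite natrM -expr2.
by apply: power_mean; rewrite -?natr_sum // exprn_ge0 // mulr_ge0 ?ltW.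
Qed.

#[local] Arguments walks : simpl never.

(** * Homomorphisms from subdivisions *)

Local Open Scope nat_scope.

Lemma sum_tupleS (T : finType) (n : nat) (F : seq T -> nat) :
  \sum_(z : n.+1.-tuple T) F z = \sum_a \sum_(z : n.-tuple T) F (a :: z).
Proof.
rewrite pair_bigA /= (reindex (fun p : T * n.-tuple T => cons_tuple p.1 p.2)) //=.
exists (fun z => (thead z, behead_tuple z)) => [[a z] _ | z _] /=.
  by congr pair; apply: val_inj.
by rewrite [z in RHS]tuple_eta; apply: val_inj.
Qed.

(** The tuple holds the inner vertices of the walk; the default value [y] of [nth] supplies its last
    vertex, at index [s.+1]. *)
Lemma sum_walk_tuples (G : sgraph) (s : nat) (x y : G) :
  \sum_(z : s.-tuple G)
    \prod_(j < s.+1) adj (nth y (x :: z) j) (nth y (x :: z) j.+1)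
  = walks s.+1 x y.
Proof.
elim: s x => [|s IHs] x.
  rewrite walks1 (bigD1 [tuple]) //= [X in (_ + X)%N]big1; last first.
    by move=> z /eqP[]; rewrite [z]tuple0.
  rewrite addn0.
  by rewrite big_ord_recl big_ord0 muln1.
rewrite (sum_tupleS _ (fun z => \prod_(j < s.+2)
  adj (nth y (x :: z) j) (nth y (x :: z) j.+1))).
rewrite walksS.
apply: eq_bigr => a _; rewrite -IHs big_distrr /=.
by apply: eq_bigr => z _; rewrite big_ord_recl.
Qed.

Section Subdivision.
Variables (s : nat) (H : sgraph).

Lemma is_hom_subdivision (G : sgraph) (f : {ffun subdivision s H -> G}) :
  is_hom f = [forall p : oedge H, forall j : 'I_s.+1,
    adj (f (subdiv_path s p j)) (f (subdiv_path s p j.+1))].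
Proof.
apply/forallP/forallP => [hf p|hf u].
  apply/forallP => j; move: (hf (subdiv_path s p j)).
  move/forallP/(_ (subdiv_path s p j.+1))/implyP; apply.
  by apply/existsP; exists p; apply/existsP; exists j; rewrite !eqxx.
apply/forallP => v; apply/implyP => /existsP[p /existsP[j]].
have /forallP/(_ j) adjf := hf p.
by case/orP => /andP[/eqP-> /eqP->] //; rewrite adj_sym.
Qed.

(** Once the images of the vertices of [H] are fixed, the paths are filled in independently, each by
    a walk of length [s.+1] between the images of its ends. *)
Lemma card_hom_subdivision (G : sgraph) :
  #|[set f : {ffun subdivision s H -> G} | is_hom f]|
  = \sum_(x : {ffun H -> G}) \prod_(p : oedge H)
      walks s.+1 (x (val p).1) (x (val p).2).
Proof.
rewrite -sum1_card big_mkcond /=.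
pose h (q : {ffun H -> G} * {ffun oedge H -> s.-tuple G}) :
    {ffun subdivision s H -> G} :=
  [ffun z => match z with inl u => q.1 u | inr (p, i) => tnth (q.2 p) i end].
rewrite (reindex h) /=; last first.
  exists (fun f => ([ffun u => f (inl u)], [ffun p => [tuple f (inr (p, i)) | i < s]])).
    case=> x y _; congr pair; apply/ffunP => u; rewrite !ffunE //.
    by apply: eq_from_tnth => i; rewrite tnth_mktuple !ffunE.
  move=> f _; apply/ffunP => -[u|[p i]]; rewrite !ffunE //=.
  by rewrite tnth_mktuple.
rewrite -(pair_bigA _ (fun x y => if h (x, y) \in _ then 1 else 0)) /=.
apply: eq_bigr => x _.
under [RHS]eq_bigr do rewrite -sum_walk_tuples.
rewrite bigA_distr_bigA /=; apply: eq_bigr => y _.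
rewrite inE is_hom_subdivision.
have hE p j : h (x, y) (subdiv_path s p j) = nth (x (val p).2) (x (val p).1 :: y p) j.
  case: j => [|j]; rewrite ffunE //=.
  case: insubP => [i _ <-|]; first by rewrite (tnth_nth (x (val p).2)).
  by rewrite -leqNgt => sj; rewrite nth_default // size_tuple.
case: ifPn => [/forallP hom|].
  rewrite big1 // => p _; rewrite big1 // => j _.
  by have /forallP/(_ j) := hom p; rewrite !hE => ->.
rewrite negb_forall => /existsP[p]; rewrite negb_forall => /existsP[j].
rewrite !hE => /negbTE nadj.
by rewrite (bigD1 p) //= (bigD1 j) //= nadj.
Qed.

Lemma card_subdivision : #|subdivision s H| = #|H| + #|oedge H| * s.
Proof. by rewrite card_sum card_prod card_ord. Qed.

Lemma subdiv_path_inj (p q : oedge H) (i j : nat) :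
  0 < i <= s -> subdiv_path s p i = subdiv_path s q j -> p = q /\ i = j.
Proof.
case: i => // i /= i_s; rewrite insubT /=; case: j => [//|j] /=.
by case: insubP => [j' _ <- [-> <-]|].
Qed.

Lemma subdiv_path0_neq (p : oedge H) (j : nat) :
  subdiv_path s p 0 <> subdiv_path s p j.+1.
Proof.
move=> /=; case: insubP => // _ [E].
by have /andP[_] := valP p; rewrite E ltnn.
Qed.

(** Each step of a path has an inner end, which records its edge of [H] and its position; the other
    end then excludes a reversed match. A lower bound on this exponent suffices, since [d <= 1]
    where it is used. *)
Lemma card_edges_subdivision : 0 < s ->
  #|oedge H| * s.+1 <= #|edges (subdivision s H)|.
Proof.
move=> s0; pose g (q : oedge H * 'I_s.+1) : {set subdivision s H} :=
  [set subdiv_path s q.1 q.2; subdiv_path s q.1 q.2.+1].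
have g_inj : injective g.
  move=> [p i] [q j] /set2_eq E.
  have {}E : subdiv_path s p i = subdiv_path s q j /\
      subdiv_path s p i.+1 = subdiv_path s q j.+1 \/
    subdiv_path s p i = subdiv_path s q j.+1 /\
      subdiv_path s p i.+1 = subdiv_path s q j by [].
  suff [pq ij] : p = q /\ i = j :> nat by rewrite pq; congr pair; apply: val_inj.
  have := ltn_ord i; have := ltn_ord j; move: E; rewrite !ltnS.
  move: (nat_of_ord i) (nat_of_ord j) => {}i {}j E js is_.
  have [i0|i0] := posnP i.
    have i1 : 0 < i.+1 <= s by rewrite i0.
    case: E => -[E1 E2]; have [pq ij] := subdiv_path_inj i1 E2.
      by split => //; case: ij.
    by move: E1; rewrite pq i0 => /subdiv_path0_neq.
  have i1 : 0 < i <= s by rewrite i0.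
  case: E => -[E1 E2]; have [pq ij] := subdiv_path_inj i1 E1; first by [].
  move: E2; rewrite pq ij => /esym; case: (posnP j) => [->|j0].
    by move/subdiv_path0_neq.
  by case/subdiv_path_inj => [|_]; lia.
rewrite -[s.+1]card_ord -card_prod -(card_imset _ g_inj).
apply/subset_leq_card/subsetP => e /imsetP[[p j] _ ->].
apply/imsetP; exists (subdiv_path s p j, subdiv_path s p j.+1) => //.
by rewrite inE /=; apply/existsP; exists p; apply/existsP; exists j; rewrite !eqxx.
Qed.

End Subdivision.

Lemma card_oedge (H : sgraph) : #|oedge H| = #|edges H|.
Proof.
pose g (p : oedge H) : {set H} := [set (val p).1; (val p).2].
have g_inj : injective g.
  move=> [[a b] /= ab] [[c d] /= cd] /set2_eq /= [] [E1 E2]; apply: val_inj => /=.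
    by rewrite E1 E2.
  by case/andP: ab cd => _; rewrite E1 E2 => dc /andP[_]; rewrite ltnNge ltnW.
rewrite -(card_imset _ g_inj); apply: eq_card => e.
apply/imsetP/imsetP => [[p _ ->]|[[a b]]].
  by exists (val p); rewrite // inE; case/andP: (valP p).
rewrite inE /= => ab ->.
have [lt|lt|eq] := ltngtP (enum_rank a) (enum_rank b).
- have abP : adj (a, b).1 (a, b).2 && (enum_rank (a, b).1 < enum_rank (a, b).2).
    by rewrite ab lt.
  by exists (exist _ (a, b) abP).
- have baP : adj (b, a).1 (b, a).2 && (enum_rank (b, a).1 < enum_rank (b, a).2).
    by rewrite adj_sym ab lt.
  by exists (exist _ (b, a) baP); rewrite // /g /= setUC.
- by move: ab; rewrite (enum_rank_inj (val_inj eq)) adj_irrefl.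
Qed.

(** Regularity enters here: every vertex lies on [r] edges, so the vertex weights [w ^ r] can be
    shared out as one factor for each end of each edge. *)
Lemma prod_oedge_regular (R : comNzRingType) (H : sgraph) (r : nat) (c : H -> R) :
  (forall v : H, #|[set w | adj v w]| = r) ->
  (\prod_(p : oedge H) (c (val p).1 * c (val p).2) = \prod_v c v ^+ r)%R.
Proof.
move=> hr; pose A (p : H * H) := adj p.1 p.2.
pose L (p : H * H) := enum_rank p.1 < enum_rank p.2.
have sub_prod (F : H * H -> R) :
    (\prod_(p : oedge H) F (val p) = \prod_(p | A p && L p) F p)%R.
  rewrite (reindex_omap (val : oedge H -> _) insub) => [|p pP]; last by rewrite insubT.
  by apply: eq_bigl => p; rewrite valK eqxx andbT; symmetry; exact: valP p.
rewrite (sub_prod (fun p => c p.1 * c p.2)%R) big_split /=.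
have -> : (\prod_(p | A p && L p) c p.2 = \prod_(p | A p && ~~ L p) c p.1)%R.
  rewrite (reindex_inj (h := fun p : H * H => (p.2, p.1))) /=; last first.
    by move=> [a b] [a' b'] [-> ->].
  apply: eq_bigl => -[a b]; rewrite /A /L /= adj_sym; case ab: (adj a b) => //=.
  rewrite -leqNgt ltn_neqAle; case: eqP => // /val_inj/enum_rank_inj E.
  by rewrite E adj_irrefl in ab.
rewrite -(bigID L) /= -(pair_big_dep xpredT (fun u v => adj u v) (fun u v => c u)) /=.
apply: eq_bigr => u _; rewrite -(hr u) -prodr_const.
by apply: eq_bigl => v; rewrite inE.
Qed.

Local Open Scope ring_scope.

(** * Blow-ups with independent samples *)

Section EdgeForm.
Variables (R : realType) (G : sgraph).
Implicit Types f g : G -> R.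

Lemma eq_edge_form f f' g g' :
  f =1 f' -> g =1 g' -> edge_form f g = edge_form f' g'.
Proof.
by move=> ff gg; apply: eq_bigr => s _; apply: eq_bigr => t _; rewrite ff gg.
Qed.

Lemma edge_form_suml (I : finType) (f : I -> G -> R) g :
  edge_form (fun s => \sum_i f i s) g = \sum_i edge_form (f i) g.
Proof.
rewrite /edge_form [RHS]exchange_big; apply: eq_bigr => s _.
rewrite [RHS]exchange_big; apply: eq_bigr => t _.
by rewrite mulr_suml mulr_sumr.
Qed.

Lemma edge_form_sumr (I : finType) f (g : I -> G -> R) :
  edge_form f (fun s => \sum_i g i s) = \sum_i edge_form f (g i).
Proof.
rewrite /edge_form [RHS]exchange_big; apply: eq_bigr => s _.
rewrite [RHS]exchange_big; apply: eq_bigr => t _.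
by rewrite !mulr_sumr.
Qed.

Lemma edge_formZ (c c' : R) f g :
  edge_form (fun s => c * f s) (fun s => c' * g s) = c * c' * edge_form f g.
Proof.
rewrite /edge_form mulr_sumr; apply: eq_bigr => s _; rewrite mulr_sumr.
by apply: eq_bigr => t _; ring.
Qed.

Lemma edge_form_combination (I J : finType) (c : I -> R) (c' : J -> R)
    (f : I -> G -> R) (g : J -> G -> R) :
  edge_form (fun s => \sum_i c i * f i s) (fun s => \sum_j c' j * g j s)
  = \sum_i \sum_j c i * c' j * edge_form (f i) (g j).
Proof.
rewrite edge_form_suml; apply: eq_bigr => i _; rewrite edge_form_sumr.
by apply: eq_bigr => j _; rewrite edge_formZ.
Qed.

Lemma edge_form_point (u v : G) :
  edge_form (fun s => (u == s)%:R : R) (fun s => (v == s)%:R) = (adj u v)%:R.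
Proof.
rewrite /edge_form (bigD1 u) //= (bigD1 v) //= !eqxx !mulr1.
rewrite big1 => [|t]; last by rewrite eq_sym => /negbTE->; rewrite !mulr0.
rewrite big1 => [|s]; first by rewrite !addr0.
by rewrite eq_sym => /negbTE->; rewrite big1 // => t _; rewrite mul0r mulr0.
Qed.

Lemma edge_form_ge0 f g :
  (forall s, 0 <= f s) -> (forall s, 0 <= g s) -> 0 <= edge_form f g.
Proof.
move=> f0 g0; rewrite !sumr_ge0 // => s _; rewrite sumr_ge0 // => t _.
by rewrite !mulr_ge0.
Qed.

Lemma edge_form_norm_le f g :
  `|edge_form f g| <= (\sum_s `|f s|) * (\sum_s `|g s|).
Proof.
rewrite big_distrlr /=; apply: le_trans (ler_norm_sum _ _ _) _.
apply: ler_sum => s _; apply: le_trans (ler_norm_sum _ _ _) _.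
apply: ler_sum => t _; rewrite !normrM normr_nat.
by case: adj; rewrite ?mul1r // mul0r mulr_ge0.
Qed.

(** One argument is replaced at a time; as adjacency is at most 1, each replacement costs its l1
    distance times the bound [B] on the other argument. *)
Lemma edge_form_perturb (B : R) f g f' g' :
  \sum_s `|g s| <= B -> \sum_s `|f' s| <= B ->
  edge_form f' g' - B * \sum_s `|f s - f' s| - B * \sum_s `|g s - g' s|
  <= edge_form f g.
Proof.
move=> gB fB.
have E : edge_form f g = edge_form f' g' + edge_form (fun s => f s - f' s) g
    + edge_form f' (fun s => g s - g' s).
  rewrite /edge_form -!big_split; apply: eq_bigr => s _.
  by rewrite -!big_split; apply: eq_bigr => t _ /=; ring.
have := edge_form_norm_le (fun s => f s - f' s) g.
have := edge_form_norm_le f' (fun s => g s - g' s).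
have D1 : 0 <= \sum_s `|f s - f' s| by rewrite sumr_ge0.
have D2 : 0 <= \sum_s `|g s - g' s| by rewrite sumr_ge0.
have := ler_wpM2l D1 gB; have := ler_wpM2r D2 fB; rewrite E !ler_norml.
by move=> ? ? /andP[? ?] /andP[? ?]; lra.
Qed.

End EdgeForm.

(** * Bessel's inequality and independent samples *)

Lemma bessel (R : realType) (I J : finType) (theta : J -> I -> R) (chi : I -> R)
    (C S : R) : 0 < C ->
  (forall j j', j != j' -> \sum_i theta j i * theta j' i = 0) ->
  (forall j, \sum_i theta j i ^+ 2 <= C) -> \sum_i chi i ^+ 2 <= S ->
  \sum_j (\sum_i chi i * theta j i) ^+ 2 <= C * S.
Proof.
move=> C0 orth thC chS; pose z j := \sum_i chi i * theta j i.
(* The scale [C] stands in for normalising the [theta j], whose square norms are only bounded above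
   by [C]. *)
have : 0 <= \sum_i (C * chi i - \sum_j z j * theta j i) ^+ 2.
  by rewrite sumr_ge0 // => i _; rewrite sqr_ge0.
have -> : \sum_i (C * chi i - \sum_j z j * theta j i) ^+ 2
  = C ^+ 2 * (\sum_i chi i ^+ 2) - (2 * C) * (\sum_j z j ^+ 2)
    + \sum_j z j ^+ 2 * \sum_i theta j i ^+ 2.
  have E2 : \sum_j z j ^+ 2 = \sum_i chi i * \sum_j z j * theta j i.
    under [RHS]eq_bigr do rewrite mulr_sumr.
    rewrite exchange_big; apply: eq_bigr => j _; rewrite expr2 {2}/z mulr_sumr.
    by apply: eq_bigr => i _; ring.
  have E3 : \sum_j z j ^+ 2 * \sum_i theta j i ^+ 2
      = \sum_i (\sum_j z j * theta j i) ^+ 2.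
    under [RHS]eq_bigr do rewrite expr2 big_distrlr /=.
    rewrite exchange_big; apply: eq_bigr => j _.
    rewrite exchange_big (bigD1 j) //= [X in _ + X]big1 ?addr0 => [|j' jj'].
      by rewrite mulr_sumr; apply: eq_bigr => i _; ring.
    under eq_bigr do rewrite mulrACA.
    by rewrite -mulr_sumr orth ?mulr0 // eq_sym.
  rewrite E2 E3 !mulr_sumr -sumrB -big_split; apply: eq_bigr => i _ /=; ring.
have zC : \sum_j z j ^+ 2 * \sum_i theta j i ^+ 2 <= C * \sum_j z j ^+ 2.
  rewrite mulr_sumr; apply: ler_sum => j _; rewrite mulrC.
  by rewrite ler_wpM2r ?sqr_ge0.
have := ler_wpM2l (sqr_ge0 C) chS.
rewrite -/(z _); move: (\sum_j z j ^+ 2) zC => Z zC cS h.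
by rewrite -(ler_pM2l C0); nra.
Qed.

Lemma sum_ffun_orthogonal (R : realType) (A Q : finType) (u : Q -> R) (b b' : A) :
  \sum_q u q = 0 -> b != b' -> \sum_(g : {ffun A -> Q}) u (g b) * u (g b') = 0.
Proof.
move=> u0 bb'.
(* Padding with the factor 1 on the other coordinates makes the sum over [g] a product of sums over
   [Q], and the one at [b] vanishes. *)
pose h i q := if i == b then u q else if i == b' then u q else 1.
transitivity (\sum_(g : {ffun A -> Q}) \prod_i h i (g i)).
  apply: eq_bigr => g _; rewrite (bigD1 b) //= (bigD1 b') //=; last by rewrite eq_sym.
  rewrite /h !eqxx; case: eqVneq bb' => // _ _; rewrite big1 ?mulr1 // => i.
  by case/andP=> /negbTE-> /negbTE->.
rewrite -bigA_distr_bigA (bigD1 b) //=; under eq_bigr do rewrite /h eqxx.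
by rewrite u0 mul0r.
Qed.

(* The number of extensions of a map [J -> Q * Q] along [c1] and [c2] does not
   depend on the map, so the sum factors. *)
Lemma sum_ffun_disjoint_pairs (R : realType) (I J Q : finType) (c1 c2 : J -> I)
    (phi : J -> Q -> Q -> R) : (0 < #|Q|)%N ->
  injective c1 -> injective c2 -> (forall j j', c1 j != c2 j') ->
  \sum_(g : {ffun I -> Q}) \prod_j phi j (g (c1 j)) (g (c2 j))
  = #|Q|%:R ^+ #|I| * \prod_j ((\sum_q \sum_q' phi j q q') / #|Q|%:R ^+ 2).
Proof.
move=> Q0 inj1 inj2 dis.
pose D (g : {ffun I -> Q}) := [ffun j => (g (c1 j), g (c2 j))].
(* [E d i] is the set of values at [i] compatible with [D g = d]: a single one if [c1] or [c2] hits
   [i], all of [Q] otherwise. *)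
pose E (d : {ffun J -> Q * Q}) (i : I) : pred Q := fun q =>
  [forall j, ((c1 j == i) ==> (q == (d j).1)) && ((c2 j == i) ==> (q == (d j).2))].
pose K := foldr muln 1%N
  [seq (if (i \in codom c1) || (i \in codom c2) then 1%N else #|Q|) | i : I].
have fiber d : #|[pred g | D g == d]| = K.
  transitivity #|family (E d)|.
    apply: eq_card => g; rewrite inE; apply/eqP/familyP => [<- i|h].
      apply/forallP => j; rewrite ffunE /=.
      by apply/andP; split; apply/implyP => /eqP->.
    apply/ffunP => j; rewrite ffunE [RHS]surjective_pairing.
    have /forallP/(_ j) := h (c1 j); rewrite eqxx /= => /andP[/eqP-> _].
    by have /forallP/(_ j) := h (c2 j); rewrite eqxx /= => /andP[_ /eqP->].
  rewrite card_family; congr foldr; apply: eq_map => i.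
  case: ifPn => [/orP[/codomP|/codomP] [j ->]|].
  - rewrite -(card1 (d j).1); apply: eq_card => q; rewrite [LHS]/in_mem [RHS]inE /=.
    apply/forallP/eqP => [/(_ j)|-> j']; first by rewrite eqxx => /andP[/eqP].
    rewrite [c2 j' == _]eq_sym (negbTE (dis _ _)) andbT.
    by apply/implyP => /eqP/inj1->.
  - rewrite -(card1 (d j).2); apply: eq_card => q; rewrite [LHS]/in_mem [RHS]inE /=.
    apply/forallP/eqP => [/(_ j)|-> j']; first by rewrite eqxx => /andP[_ /eqP].
    by rewrite (negbTE (dis _ _)); apply/implyP => /eqP/inj2->.
  - rewrite negb_or => /andP[n1 n2]; apply: eq_card => q.
    rewrite [LHS]/in_mem [RHS]inE /=; apply/forallP => j.
    apply/andP; split; apply/implyP => /eqP ji.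
      by move: n1; rewrite -ji codom_f.
    by move: n2; rewrite -ji codom_f.
have sumK (ph : J -> Q -> Q -> R) :
    \sum_(g : {ffun I -> Q}) \prod_j ph j (g (c1 j)) (g (c2 j))
    = K%:R * \prod_j \sum_q \sum_q' ph j q q'.
  rewrite (partition_big D xpredT) //=.
  under [X in _ * X]eq_bigr do rewrite pair_bigA /=.
  rewrite bigA_distr_bigA mulr_sumr; apply: eq_bigr => d _ /=.
  rewrite -(fiber d) mulr_natl -sumr_const; apply: eq_bigr => g /eqP <-.
  by apply: eq_bigr => j _; rewrite ffunE.
have nQ : #|Q|%:R != 0 :> R by rewrite pnatr_eq0 -lt0n.
(* [K] is evaluated by applying [sumK] itself to the constant function 1. *)
have KE : #|Q|%:R ^+ #|I| = K%:R * (#|Q|%:R ^+ 2) ^+ #|J| :> R.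
  have <- : \sum_(g : {ffun I -> Q}) \prod_(j : J) 1 = #|Q|%:R ^+ #|I| :> R.
    rewrite -natrX -card_ffun -sumr_const; apply: eq_bigr => g _.
    by rewrite big1.
  rewrite (sumK (fun _ _ _ => 1)) -prodr_const; congr (_ * _).
  apply: eq_bigr => j _; rewrite expr2 mulr_natl -sumr_const.
  by apply: eq_bigr => q _; rewrite sumr_const.
rewrite sumK KE big_split /= prodfV prodr_const -mulrA; congr (_ * _).
by rewrite mulrCA mulfV ?mulr1 // !expf_neq0.
Qed.

(** * Local density of the blow-up *)

Section Blowup.
Variables (G : sgraph) (V Q : finType) (psi : V -> Q -> G) (a : nat).

(* A vertex [(v, i, g)] carries a sample [g j : Q] for each index [j]. Adjacency of
   [(v, i, g)] and [(w, j, h)] is read off from the samples [g j] and [h i], so the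
   adjacencies between vertices with distinct indices use disjoint sets of samples. *)
Definition blowup_vertex : finType := (V * 'I_a * {ffun 'I_a -> Q})%type.

Definition blowup_adj : rel blowup_vertex := fun x y =>
  adj (psi x.1.1 (x.2 y.1.2)) (psi y.1.1 (y.2 x.1.2)).

Lemma blowup_adj_sym : symmetric blowup_adj.
Proof. by move=> x y; rewrite /blowup_adj adj_sym. Qed.

Lemma blowup_adj_irrefl : irreflexive blowup_adj.
Proof. by move=> x; rewrite /blowup_adj adj_irrefl. Qed.

Definition blowup : sgraph := SGraph blowup_adj_sym blowup_adj_irrefl.

Lemma card_blowup : #|blowup| = (#|V| * a * #|Q| ^ a)%N.
Proof. by rewrite !card_prod card_ffun !card_ord. Qed.

Variable R : realType.

Definition law (v : V) (t : G) : R := #|[set q | psi v q == t]|%:R / #|Q|%:R.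

Definition kernel (v w : V) : R := edge_form (law v) (law w).

Hypothesis Q_gt0 : (0 < #|Q|)%N.

Let nQ : #|Q|%:R != 0 :> R.
Proof. by rewrite pnatr_eq0 -lt0n. Qed.

Lemma lawE v t : law v t = \sum_q #|Q|%:R^-1 * (psi v q == t)%:R.
Proof.
rewrite /law -sum1_card natr_sum mulr_suml [LHS]big_mkcond /=.
by apply: eq_bigr => q _; rewrite inE mulrC; case: eqP; rewrite ?mulr0 ?mulr1.
Qed.

Lemma law_ge0 v t : 0 <= law v t.
Proof. exact: divr_ge0. Qed.

Lemma law_le1 v t : law v t <= 1.
Proof. by rewrite ler_pdivrMr ?ltr0n // mul1r ler_nat max_card. Qed.

Lemma sum_point (u : G) : \sum_t (u == t)%:R = 1 :> R.
Proof.
by rewrite (bigD1 u) //= eqxx big1 ?addr0 // => t; rewrite eq_sym => /negbTE->.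
Qed.

Lemma sum_law v : \sum_t law v t = 1.
Proof.
under eq_bigr do rewrite lawE.
rewrite exchange_big (eq_bigr (fun _ => #|Q|%:R^-1)) => [|q _].
  by rewrite sumr_const -[LHS]mulr_natl mulfV.
by rewrite -mulr_sumr sum_point mulr1.
Qed.

Lemma kernel_ge0 v w : 0 <= kernel v w.
Proof. by apply: edge_form_ge0 => t; apply: law_ge0. Qed.

Lemma kernelE v w :
  kernel v w = (\sum_q \sum_q' (adj (psi v q) (psi w q'))%:R) / #|Q|%:R ^+ 2.
Proof.
rewrite /kernel (eq_edge_form (lawE v) (lawE w)) edge_form_combination.
rewrite mulr_suml; apply: eq_bigr => q _; rewrite mulr_suml.
apply: eq_bigr => q' _; rewrite edge_form_point mulrC; congr (_ * _).
by rewrite expr2 invfM.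
Qed.

Lemma sum_blowup (F : blowup_vertex -> R) :
  \sum_x F x = \sum_i \sum_(p : V * {ffun 'I_a -> Q}) F (p.1, i, p.2).
Proof.
rewrite pair_bigA /=.
rewrite (reindex (fun p : 'I_a * (V * {ffun 'I_a -> Q}) => (p.2.1, p.1, p.2.2))) //=.
by exists (fun x => (x.1.2, (x.1.1, x.2))) => [[i [v g]]|[[v i] g]].
Qed.

(** For each pair of indices, the sampled mass [F2 i j] of [X] is replaced by its averaged version
    [F1 i], to which the hypothesis on [kernel] applies. Samples at different positions are
    orthogonal, so by Bessel's inequality [F2 i j] is close to [F1 i] for most [j]; [eta] measures
    the loss. *)
Lemma blowup_dense (rho d d' eta : R) : (0 < #|V|)%N -> 0 < rho -> 0 < eta ->
  1 <= a%:R * eta ^+ 2 -> 2 * #|G|%:R * eta <= (d - d') * rho ^+ 2 ->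
  (forall F : V -> R, (forall v, 0 <= F v <= 1) -> rho * #|V|%:R <= \sum_v F v ->
     d * (\sum_v F v) ^+ 2 <= \sum_v \sum_w F v * F w * kernel v w) ->
  dense rho d' blowup.
Proof.
move=> V0 rho0 eta0 a_eta eta_d dK X; rewrite card_blowup => rX.
have a0 : (0 < a)%N by rewrite lt0n; apply: contraTneq a_eta => ->; rewrite mul0r ler10.
pose I : finType := (V * {ffun 'I_a -> Q})%type.
pose B : R := #|I|%:R.
have BE : B = #|V|%:R * #|Q|%:R ^+ a.
  by rewrite /B card_prod card_ffun card_ord natrM natrX.
have B0 : 0 < B by rewrite BE mulr_gt0 ?exprn_gt0 ?ltr0n.
pose chi i (p : I) : R := ((p.1, i, p.2) \in X)%:R.
have chi0 i p : 0 <= chi i p by rewrite ler0n.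
have chi1 i p : chi i p <= 1 by rewrite /chi; case: (_ \in X).
(* [F2 i j t] counts the vertices of [X] of index [i] whose [j]-th sample lands on [t]; in [F1 i t]
   that sample is averaged over its law. *)
pose F2 i j t := \sum_p chi i p * (psi p.1 (p.2 j) == t)%:R.
pose F1 i t := \sum_p chi i p * law p.1 t.
have massB i : \sum_p chi i p <= B.
  by rewrite -[B]sumr_const; apply: ler_sum => p _.
have F2_ge0 i j t : 0 <= F2 i j t by rewrite sumr_ge0 // => p _; rewrite mulr_ge0.
have F1_ge0 i t : 0 <= F1 i t.
  by rewrite sumr_ge0 // => p _; rewrite mulr_ge0 ?law_ge0.
have F2B i j : \sum_t `|F2 i j t| <= B.
  under eq_bigr do rewrite ger0_norm //.
  rewrite exchange_big; apply: le_trans (massB i); apply: ler_sum => p _ /=.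
  by rewrite -mulr_sumr sum_point mulr1.
have F1B i : \sum_t `|F1 i t| <= B.
  under eq_bigr do rewrite ger0_norm //.
  rewrite exchange_big; apply: le_trans (massB i); apply: ler_sum => p _ /=.
  by rewrite -mulr_sumr sum_law mulr1.
have sumX : \sum_i \sum_p chi i p = #|X|%:R.
  rewrite -sum1_card natr_sum [RHS]big_mkcond /= sum_blowup.
  by apply: eq_bigr => i _; apply: eq_bigr => p _; rewrite /chi; case: (_ \in X).
have XE : 2 * #|edges_in X|%:R = \sum_i \sum_j edge_form (F2 i j) (F2 j i).
  rewrite -edge_form_indicator /edge_form sum_blowup; apply: eq_bigr => i _.
  under [LHS]eq_bigr do rewrite sum_blowup.
  rewrite exchange_big; apply: eq_bigr => j _ /=.
  rewrite [RHS]edge_form_combination; apply: eq_bigr => p _; apply: eq_bigr => p' _.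
  by rewrite edge_form_point mulrC.
have main : d * #|X|%:R ^+ 2 <= \sum_i \sum_j edge_form (F1 i) (F1 j).
  have -> : \sum_i \sum_j edge_form (F1 i) (F1 j)
      = edge_form (fun t => \sum_i F1 i t) (fun t => \sum_i F1 i t).
    rewrite edge_form_suml; apply: eq_bigr => i _.
    by rewrite edge_form_sumr.
  pose c v := \sum_i \sum_g chi i (v, g).
  have F1c t : \sum_i F1 i t = \sum_v c v * law v t.
    rewrite [RHS](eq_bigr (fun v => \sum_i \sum_g chi i (v, g) * law v t)).
      rewrite [RHS]exchange_big; apply: eq_bigr => i _.
      by rewrite pair_bigA; apply: eq_bigr => -[].
    by move=> v _; rewrite mulr_suml; apply: eq_bigr => i _; rewrite mulr_suml.
  have sumc : \sum_v c v = #|X|%:R.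
    rewrite -sumX [LHS]exchange_big; apply: eq_bigr => i _.
    by rewrite pair_bigA; apply: eq_bigr => -[].
  rewrite (eq_edge_form F1c F1c) edge_form_combination.
  (* [M] is the number of vertices of the blow-up over each [v], so [c v / M] is an admissible
     weight. *)
  pose M : R := a%:R * #|Q|%:R ^+ a.
  have M0 : 0 < M by rewrite mulr_gt0 ?exprn_gt0 ?ltr0n.
  have c01 v : 0 <= c v / M <= 1.
    rewrite divr_ge0 ?(ltW M0) ?sumr_ge0 //=; last by move=> i _; rewrite sumr_ge0.
    rewrite ler_pdivrMr // mul1r /c /M mulr_natl -[X in _ *+ X]card_ord -sumr_const.
    have cardF : #|{ffun 'I_a -> Q}| = (#|Q| ^ a)%N by rewrite card_ffun card_ord.
    apply: ler_sum => i _; rewrite -natrX -cardF -sumr_const.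
    by apply: ler_sum => g _.
  have := dK _ c01; rewrite -mulr_suml sumc.
  have -> : rho * #|V|%:R <= #|X|%:R / M.
    rewrite ler_pdivlMr // -mulrA; apply: le_trans rX.
    by rewrite !natrM natrX /M -!mulrA.
  move=> /(_ isT); rewrite exprMn exprVn mulrA ler_pdivrMr ?exprn_gt0 //.
  rewrite mulr_suml; congr (_ <= _); apply: eq_bigr => v _.
  rewrite mulr_suml; apply: eq_bigr => w _; rewrite /kernel.
  by field; rewrite gt_eqF.
have bess i t : \sum_j (F2 i j t - F1 i t) ^+ 2 <= B ^+ 2.
  pose theta j (p : I) : R := (psi p.1 (p.2 j) == t)%:R - law p.1 t.
  have th0 v : \sum_q ((psi v q == t)%:R - law v t) = 0.
    rewrite sumrB sumr_const -mulr_natl lawE -mulr_sumr mulrA mulfV // mul1r.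
    by rewrite subrr.
  have -> : \sum_j (F2 i j t - F1 i t) ^+ 2
      = \sum_j (\sum_p chi i p * theta j p) ^+ 2.
    apply: eq_bigr => j _; rewrite -sumrB; congr (_ ^+ 2).
    by apply: eq_bigr => p _; rewrite mulrBr.
  rewrite expr2; apply: bessel => // [j j' jj'|j|].
  - rewrite -(pair_bigA _ (fun v g => theta j (v, g) * theta j' (v, g))) /=.
    rewrite big1 // => v _.
    exact: (sum_ffun_orthogonal (th0 v) jj').
  - rewrite -[B]sumr_const; apply: ler_sum => p _; rewrite /theta.
    have := law_ge0 p.1 t; have := law_le1 p.1 t.
    by case: (_ == t) => /=; nra.
  - rewrite -[B]sumr_const; apply: ler_sum => p _.
    by rewrite expr_le1.
have dev i t : \sum_j `|F2 i j t - F1 i t| <= a%:R * eta * B.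
  (* The inequality of means at scale [eta * B] passes from squares to absolute values;
     [1 <= a%:R * eta ^+ 2] makes the square part at most the constant part after summing over
     [j]. *)
  have amgm (x : R) : `|x| <= (eta * B + x ^+ 2 / (eta * B)) / 2.
    have e0 : 0 < eta * B by rewrite mulr_gt0.
    have : 0 <= (`|x| - eta * B) ^+ 2 / (eta * B) by rewrite divr_ge0 ?sqr_ge0 ?ltW.
    have -> : (`|x| - eta * B) ^+ 2 / (eta * B)
        = `|x| ^+ 2 / (eta * B) - 2 * `|x| + eta * B by field; rewrite !gt_eqF.
    by rewrite real_normK ?num_real //; lra.
  apply: le_trans (ler_sum _ (fun j _ => amgm _)) _.
  rewrite -mulr_suml big_split /= sumr_const card_ord -mulr_suml -[eta * B *+ _]mulr_natl.
  have : (\sum_j (F2 i j t - F1 i t) ^+ 2) / (eta * B) <= a%:R * eta * B.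
    rewrite ler_pdivrMr ?mulr_gt0 //; apply: le_trans (bess i t) _.
    have := ler_wpM2r (sqr_ge0 B) a_eta; lra.
  by lra.
pose D i j := \sum_t `|F2 i j t - F1 i t|.
have sumD : \sum_i \sum_j D i j <= a%:R * (#|G|%:R * (a%:R * eta * B)).
  rewrite [leRHS]mulr_natl -[X in _ *+ X]card_ord -sumr_const; apply: ler_sum => i _.
  rewrite exchange_big mulr_natl -sumr_const; apply: ler_sum => t _.
  exact: dev.
have pert : \sum_i \sum_j edge_form (F1 i) (F1 j)
    - B * (\sum_i \sum_j D i j) - B * (\sum_i \sum_j D i j)
    <= \sum_i \sum_j edge_form (F2 i j) (F2 j i).
  have swap : \sum_i \sum_j D i j = \sum_i \sum_j D j i by exact: exchange_big.
  rewrite {2}swap !mulr_sumr -!sumrB; apply: ler_sum => i _.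
  rewrite !mulr_sumr -!sumrB; apply: ler_sum => j _.
  exact: edge_form_perturb.
have X2 : rho ^+ 2 * (a%:R * B) ^+ 2 <= #|X|%:R ^+ 2.
  rewrite -exprMn lerXn2r ?nnegrE ?mulr_ge0 ?(ltW rho0) ?(ltW B0) // BE.
  by apply: le_trans rX; rewrite !natrM natrX le_eqVlt; apply/orP; left; apply/eqP; ring.
have := ler_wpM2l (ltW B0) sumD.
have := ler_wpM2r (sqr_ge0 (a%:R * B)) eta_d.
have dd' : 0 <= d - d'.
  rewrite -(pmulr_lge0 _ (exprn_gt0 2 rho0)); apply: le_trans eta_d.
  by rewrite !mulr_ge0 // ltW.
have := ler_wpM2l dd' X2.
rewrite -XE in pert.
suff fin (A S x e b n : R) : d * x ^+ 2 <= A -> A - B * S - B * S <= 2 * e ->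
    (d - d') * (rho ^+ 2 * (b * B) ^+ 2) <= (d - d') * x ^+ 2 ->
    2 * n * eta * (b * B) ^+ 2 <= (d - d') * rho ^+ 2 * (b * B) ^+ 2 ->
    B * S <= B * (b * (n * (b * eta * B))) -> d' / 2 * x ^+ 2 <= e.
  exact: fin main pert.
clearbody B; lra.
Qed.

End Blowup.

(** * Homomorphism density of the blow-up *)

Lemma leq_expn_ffact (a m : nat) : (a ^_ m <= a ^ m)%N.
Proof.
by elim: m => // m IHm; rewrite ffactnSr expnSr leq_mul // leq_subr.
Qed.

(** A union bound over colliding pairs, their number rounded up to a square; it makes the
    non-injective index maps negligible for large [a]. *)
Lemma card_noninjective_ffun (D : finType) (a : nat) :
  (#|[set f : {ffun D -> 'I_a} | ~~ injectiveb f]| * a <= #|D| ^ 2 * a ^ #|D|)%N.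
Proof.
have -> : #|[set f : {ffun D -> 'I_a} | ~~ injectiveb f]|
    = (a ^ #|D| - a ^_ #|D|)%N.
  have <- : ~: [set f : {ffun D -> 'I_a} | injectiveb f]
      = [set f : {ffun D -> 'I_a} | ~~ injectiveb f] by apply/setP => f; rewrite !inE.
  by rewrite cardsCs setCK card_inj_ffuns card_ffun card_ord.
rewrite mulnBl leq_subLR; elim: #|D| => [|m IHm]; first by rewrite !expn0 ffactn0; lia.
rewrite ffactnSr expnSr; have := leq_expn_ffact a m.
move: (a ^_ m)%N (a ^ m)%N IHm => f e IHm fe.
have h1 : (e * a * a <= (f * a + m ^ 2 * e) * a)%N by rewrite leq_mul2r IHm orbT.
have h2 : (f * a * a <= f * (a - m) * a + m * e * a)%N.
  have : (f * (a * a) <= f * ((a - m) * a + m * a))%N.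
    by rewrite leq_mul2l; apply/orP; right; rewrite -mulnDl leq_mul2r; lia.
  have : (f * (m * a) <= e * (m * a))%N by rewrite leq_mul2r fe orbT.
  lia.
have : (0 <= m * (e * a))%N by [].
lia.
Qed.

Section BlowupHom.
Variables (R : realType) (H G : sgraph) (V Q : finType) (psi : V -> Q -> G) (a : nat).
Hypotheses (V_gt0 : (0 < #|V|)%N) (Q_gt0 : (0 < #|Q|)%N) (a_gt0 : (0 < a)%N).

Let code (q : {ffun H -> V} * {ffun H -> 'I_a} * {ffun H * 'I_a -> Q}) :
    {ffun H -> blowup psi a} :=
  [ffun u => (q.1.1 u, q.1.2 u, [ffun i => q.2 (u, i)])].

Let code_bij : bijective code.
Proof.
exists (fun f : {ffun H -> blowup psi a} => ([ffun u => (f u).1.1],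
  [ffun u => (f u).1.2], [ffun p : H * 'I_a => (f p.1).2 p.2])).
  case=> -[v al] g; congr (_, _, _); apply/ffunP => [u].
  - by rewrite !ffunE.
  - by rewrite !ffunE.
  - by case: u => u i; rewrite !ffunE.
move=> f; apply/ffunP => u; rewrite !ffunE /=.
case E : (f u) => [[v i] g]; congr (_, _, _).
by apply/ffunP => j; rewrite !ffunE /= E.
Qed.

(** With distinct indices, an edge [uv] reads the samples at [(u, al v)] and [(v, al u)]. No two
    edges share a sample, so the required adjacencies are independent. *)
Lemma sum_blowup_hom_injective (v : {ffun H -> V}) (al : {ffun H -> 'I_a}) :
  injective al ->
  \sum_(g : {ffun H * 'I_a -> Q}) (is_hom (code (v, al, g)))%:R
  <= #|Q|%:R ^+ (#|H| * a) *
     \prod_(p : oedge H) kernel psi R (v (val p).1) (v (val p).2).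
Proof.
move=> al_inj.
pose c1 (p : oedge H) := ((val p).1, al (val p).2).
pose c2 (p : oedge H) := ((val p).2, al (val p).1).
have inj1 : injective c1.
  move=> [[x y] xy] [[x' y'] xy'] [/= E1 /al_inj E2]; apply: val_inj => /=.
  by rewrite E1 E2.
have inj2 : injective c2.
  move=> [[x y] xy] [[x' y'] xy'] [/= E1 /al_inj E2]; apply: val_inj => /=.
  by rewrite E1 E2.
(* A coincidence would make one edge the reversal of the other, against the orientation fixed by
   [oedge]. *)
have dis p p' : c1 p != c2 p'.
  apply/eqP; case: p p' => [[x y] /= xy] [[x' y'] /= xy'] [/= E1 /al_inj E2].
  case/andP: xy xy' => _ xy /andP[_]; rewrite -E1 -E2.
  by rewrite ltnNge ltnW.
have := sum_ffun_disjoint_pairs (fun p q q' =>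
  (adj (psi (v (val p).1) q) (psi (v (val p).2) q'))%:R : R) Q_gt0 inj1 inj2 dis.
rewrite card_prod card_ord.
under [X in _ = _ * X]eq_bigr do rewrite -kernelE //.
move=> <-; apply: ler_sum => g _.
have [/forallP hom|_] := boolP (is_hom _); last by rewrite prodr_ge0.
rewrite big1 // => p _; have /forallP/(_ (val p).2) := hom (val p).1.
have /andP[-> _] := valP p.
by rewrite /= /blowup_adj !ffunE /= => ->.
Qed.

(** Injective index maps give the kernel sum; the others are bounded trivially and make up a
    proportion of at most [#|H| ^ 2 / a]. *)
Lemma blowup_hom_density :
  hom_density R H (blowup psi a) <=
  (\sum_(v : {ffun H -> V}) \prod_(p : oedge H)
      kernel psi R (v (val p).1) (v (val p).2)) / #|V|%:R ^+ #|H|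
  + #|H|%:R ^+ 2 / a%:R.
Proof.
rewrite /hom_density card_ffun card_blowup -sum1_card natr_sum big_mkcond /=.
rewrite (reindex code) /=; last exact: onW_bij code_bij.
pose P (v : {ffun H -> V}) :=
  \prod_(p : oedge H) kernel psi R (v (val p).1) (v (val p).2).
rewrite -[\sum_(v : {ffun H -> V}) _]/(\sum_v P v).
pose q : R := #|Q|%:R ^+ (#|H| * a).
have q0 : 0 < q by rewrite exprn_gt0 // ltr0n.
have P0 v : 0 <= P v by rewrite prodr_ge0 // => p _; rewrite kernel_ge0.
have bound : \sum_f (if code f \in [set f | is_hom f] then 1 else 0)
  <= \sum_(v : {ffun H -> V}) \sum_(al : {ffun H -> 'I_a})
      (q * P v + q * (~~ injectiveb al)%:R).
  rewrite -(pair_bigA _ (fun x g =>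
    if code (x, g) \in [set f | is_hom f] then 1 else 0)) /=.
  rewrite -(pair_bigA _ (fun v al => \sum_g
    if code (v, al, g) \in [set f | is_hom f] then 1 else 0)) /=.
  apply: ler_sum => v _; apply: ler_sum => al _.
  rewrite (eq_bigr (fun g => (is_hom (code (v, al, g)))%:R)) => [|g _]; last first.
    by rewrite inE; case: is_hom.
  have [/injectiveP inj|_] := boolP (injectiveb al).
    by rewrite mulr0 addr0; apply: sum_blowup_hom_injective.
  apply: (@le_trans _ _ q); last by rewrite mulr1 lerDr mulr_ge0 // ltW.
  have -> : q = #|{ffun H * 'I_a -> Q}|%:R.
    by rewrite card_ffun card_prod card_ord natrX.
  by rewrite -sumr_const; apply: ler_sum => g _; case: is_hom.
have V0 : 0 < #|V|%:R ^+ #|H| :> R by rewrite exprn_gt0 // ltr0n.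
have a0 : 0 < a%:R :> R by rewrite ltr0n.
have am0 : 0 < a%:R ^+ #|H| :> R by rewrite exprn_gt0.
rewrite !natrX !natrM natrX !exprMn -exprM [(a * _)%N]mulnC -/q.
rewrite ler_pdivrMr ?mulr_gt0 //; apply: le_trans bound _.
rewrite (eq_bigr (fun v => a%:R ^+ #|H| * q * P v
  + q * #|[set f : {ffun H -> 'I_a} | ~~ injectiveb f]|%:R)) => [|v _]; last first.
  rewrite big_split /= sumr_const card_ffun card_ord -[q * P v *+ _]mulr_natl natrX.
  rewrite mulrA -mulr_sumr; congr (_ + _ * _).
  rewrite -sum1_card natr_sum [RHS]big_mkcond /=.
  by apply: eq_bigr => f _; rewrite inE; case: injectiveb.
rewrite big_split /= -mulr_sumr sumr_const card_ffun -[X in _ + X]mulr_natl natrX.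
rewrite mulrDl lerD //.
  by rewrite le_eqVlt; apply/orP; left; apply/eqP; field; rewrite gt_eqF.
have nonE : #|[set f : {ffun H -> 'I_a} | ~~ injectiveb f]|%:R * a%:R
    <= #|H|%:R ^+ 2 * a%:R ^+ #|H| :> R.
  by rewrite -!natrX -!natrM ler_nat card_noninjective_ffun.
rewrite [leRHS]mulrAC ler_pdivlMr //.
have := ler_wpM2l (ltW (mulr_gt0 V0 q0)) nonE; lra.
Qed.

End BlowupHom.

(** The constant [c] survives intact: the kernel sum does not depend on [a], so the additive error
    [tau] of the blow-up can be made arbitrarily small. *)
Lemma KNRS_kernel (R : realType) (H G : sgraph) (V Q : finType) (psi : V -> Q -> G)
    (rho d d' c : R) (N : nat) :
  (0 < #|V|)%N -> (0 < #|Q|)%N -> 0 < rho -> d' < d ->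
  (forall G' : sgraph, (N <= #|G'|)%N -> dense rho d' G' -> c <= hom_density R H G') ->
  (forall F : V -> R, (forall v, 0 <= F v <= 1) -> rho * #|V|%:R <= \sum_v F v ->
     d * (\sum_v F v) ^+ 2 <= \sum_v \sum_w F v * F w * kernel psi R v w) ->
  c * #|V|%:R ^+ #|H| <= \sum_(v : {ffun H -> V}) \prod_(p : oedge H)
      kernel psi R (v (val p).1) (v (val p).2).
Proof.
move=> V0 Q0 rho0 dd' hN dK; set S := \sum_v _.
have VH0 : 0 < #|V|%:R ^+ #|H| :> R by rewrite exprn_gt0 // ltr0n.
rewrite -ler_pdivlMr //; apply/ler_addgt0Pr => tau tau0.
have G0 : 0 < #|G|%:R :> R.
  have /card_gt0P[v _] := V0; have /card_gt0P[q _] := Q0.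
  by rewrite ltr0n; apply/card_gt0P; exists (psi v q).
pose eta := (d - d') * rho ^+ 2 / (2 * #|G|%:R).
have eta0 : 0 < eta by rewrite divr_gt0 ?mulr_gt0 ?exprn_gt0 ?subr_gt0.
(* The three summands ensure that the blow-up has at least [N] vertices, that its error is at most
   [tau], and that [1 <= a%:R * eta ^+ 2]. *)
pose a := (N + Num.bound (#|H|%:R ^+ 2 / tau) + Num.bound (eta ^+ 2)^-1).+1.
have boundP (x : R) m : 0 <= x -> (Num.bound x <= m)%N -> x <= m%:R.
  move=> x0 xm; apply/ltW/(lt_le_trans (archi_boundP x0)).
  by rewrite ler_nat.
have a1 : 1 <= a%:R * eta ^+ 2.
  rewrite -ler_pdivrMr ?exprn_gt0 // div1r; apply: boundP; last by rewrite leqW ?leq_addl.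
  by rewrite invr_ge0 sqr_ge0.
have a2 : #|H|%:R ^+ 2 / a%:R <= tau.
  rewrite ler_pdivrMr ?ltr0n // -ler_pdivrMl // mulrC.
  apply: boundP; last by rewrite leqW // -addnA addnCA leq_addr.
  by rewrite divr_ge0 ?sqr_ge0 ?ltW.
have := hN (blowup psi a); rewrite card_blowup.
have -> : (N <= #|V| * a * #|Q| ^ a)%N.
  have Qa : (0 < #|Q| ^ a)%N by rewrite expn_gt0 Q0.
  have Na : (N <= a)%N by rewrite leqW // -addnA leq_addr.
  by rewrite -[N]muln1 leq_mul // -[N]mul1n leq_mul.
move=> /(_ isT) h; apply: le_trans (h _) _.
  apply: (blowup_dense Q0 V0 rho0 eta0 a1 _ dK).
  by rewrite /eta mulrC divfK // gt_eqF // mulr_gt0.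
apply: le_trans (blowup_hom_density R H psi V0 Q0 (ltn0Sn _)) _.
by rewrite lerD2l.
Qed.

(** * The walk kernel *)

Lemma sum_modn (F : nat -> nat) (w m : nat) :
  (\sum_(0 <= i < m * w) F (i %% w) = m * \sum_(0 <= i < w) F i)%N.
Proof.
elim: m => [|m IHm]; first by rewrite !mul0n big_geq.
rewrite (@big_cat_nat _ _ _ (m * w)%N) ?leq_mul2r ?leqnSn ?orbT //= IHm.
rewrite [RHS]mulSnr; congr (_ + _)%N; rewrite -{1}[(m * w)%N]add0n big_addn mulSn addnK.
rewrite !big_nat; apply: eq_bigr => i /andP[_ iw].
by rewrite addnC modnMDl modn_small.
Qed.

(* A common sample space on which each law with integer weights [c x] is realised
   exactly; nothing is asserted when all the weights of [x] vanish. *)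
Lemma common_sample_space (T : finType) (c : T -> T -> nat) :
  exists2 M : nat, (0 < M)%N & exists psi : T -> 'I_M -> T, forall x t,
    (0 < \sum_u c x u)%N ->
    (#|[set q | psi x q == t]| * \sum_u c x u = M * c x t)%N.
Proof.
(* [L x] repeats each [u] with multiplicity [c x u], and a sample [q] picks the entry at position
   [q] modulo [W x]. When [W x] is positive it divides [M], so all positions are hit equally
   often. *)
pose L x := flatten [seq nseq (c x u) u | u <- enum T].
pose W x := (\sum_u c x u)%N.
have countL x (P : pred T) : count P (L x) = (\sum_u P u * c x u)%N.
  rewrite count_flatten sumnE 2!big_map big_enum; apply: eq_bigr => u _.
  by rewrite count_nseq.
have sizeL x : size (L x) = W x.
  by rewrite -count_predT countL; apply: eq_bigr => u _; rewrite mul1n.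
pose M := (\prod_x maxn 1 (W x))%N.
have M0 : (0 < M)%N by rewrite prodn_gt0 // => x; rewrite leq_maxl.
exists M => //; exists (fun x (q : 'I_M) => nth x (L x) (q %% W x)) => x t Wx.
have [m ME] : exists m, M = (m * W x)%N.
  exists (\prod_(y | y != x) maxn 1 (W y))%N.
  by rewrite /M (bigD1 x) //= mulnC (maxn_idPr Wx).
have -> : #|[set q : 'I_M | nth x (L x) (q %% W x) == t]| = (m * c x t)%N.
  rewrite -sum1_card big_mkcond /=.
  transitivity (\sum_(0 <= i < M) (nth x (L x) (i %% W x) == t))%N.
    by rewrite big_mkord; apply: eq_bigr => q _; rewrite inE; case: eqP.
  rewrite ME (sum_modn (fun i => nth x (L x) i == t : nat)); congr (_ * _)%N.
  transitivity (count (pred1 t) (L x)).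
    rewrite -sum1_count (big_nth x) sizeL [RHS]big_mkcond /=.
    by apply: eq_bigr => i _; case: eqP.
  rewrite countL (bigD1 t) //= eqxx mul1n big1 ?addn0 // => u /negbTE->.
  by rewrite mul0n.
by rewrite ME mulnAC.
Qed.

(** * Vertex weights as multiplicities *)

Section Tagged.
Variables (R : realType) (T : finType) (m : T -> nat).

Lemma sum_tagged_ord (F : T -> R) :
  \sum_(v : {x : T & 'I_(m x)}) F (tag v) = \sum_x (m x)%:R * F x.
Proof.
transitivity (\sum_x \sum_(i : 'I_(m x)) F x).
  by rewrite (sig_big_dep _ (fun _ _ => true) (fun x _ => F x)).
apply: eq_bigr => x _.
by rewrite sumr_const card_ord mulr_natl.
Qed.

(** Each map [x] has one lift for every choice of copies of its values, which is how multiplicities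
    become products of vertex weights. *)
Lemma sum_ffun_tagged_ord (I : finType) (F : {ffun I -> T} -> R) :
  \sum_(v : {ffun I -> {x : T & 'I_(m x)}}) F [ffun i => tag (v i)]
  = \sum_(x : {ffun I -> T}) (\prod_i (m (x i))%:R) * F x.
Proof.
rewrite (partition_big (fun v : {ffun I -> {x : T & 'I_(m x)}} =>
  [ffun i => tag (v i)]) xpredT) //=; apply: eq_bigr => x _.
rewrite (eq_bigr (fun _ => F x)) => [|v /eqP-> //].
transitivity ((\sum_(v : {ffun I -> {x : T & 'I_(m x)}})
    \prod_i (tag (v i) == x i)%:R) * F x).
  rewrite mulr_suml big_mkcond; apply: eq_bigr => v _ /=.
  case: eqP => [<-|ne].
    by rewrite big1 ?mul1r // => i _; rewrite ffunE eqxx.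
  have [i ni] : exists i, tag (v i) != x i.
    apply/existsP; rewrite -negb_forall; apply/negP => /forallP h.
    by case: ne; apply/ffunP => i; rewrite ffunE; apply/eqP.
  by rewrite (bigD1 i) //= (negbTE ni) !mul0r.
rewrite -(bigA_distr_bigA (fun i (v : {x : T & 'I_(m x)}) => (tag v == x i)%:R)) /=.
congr (_ * _); apply: eq_bigr => i _.
rewrite (sum_tagged_ord (fun y => (y == x i)%:R)) (bigD1 (x i)) //= eqxx mulr1.
by rewrite big1 ?addr0 // => y /negbTE->; rewrite mulr0.
Qed.

End Tagged.

(** * From walk counts to the subdivision *)

Lemma dense_le1 (R : realType) (rho d : R) (G : sgraph) :
  rho <= 1 -> (0 < #|G|)%N -> dense rho d G -> d <= 1.
Proof.
move=> rho1 G0 /(_ [set: G]); rewrite cardsT edges_in_setT => dG.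
have n0 : 0 < #|G|%:R :> R by rewrite ltr0n.
have {dG} := dG _; rewrite -{2}[#|G|%:R]mul1r ler_pM2r // => /(_ rho1) dG.
have : (2 * #|edges G|)%:R <= #|G|%:R ^+ 2 :> R.
  by rewrite -edges_in_setT -card_adj_in -natrX ler_nat -mulnn -card_prod max_card.
rewrite natrM => e2; rewrite -(ler_pM2r (exprn_gt0 2 n0)); lra.
Qed.

(** [KNRS_kernel] is applied to [w x ^ r] copies of each vertex [x], sampled by the end of a random
    [k]-walk from [x]. The first bound on [rho] provides many walks, the second makes the kernel
    locally dense. *)
Lemma sum_walks_ge (R : realType) (H G : sgraph) (k r N : nat)
    (a d c rho rho' : R) :
  (forall v : H, #|[set w | adj v w]| = r) -> (0 < r)%N -> (0 < #|G|)%N ->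
  0 < d <= 1 -> 0 < a < 1 -> 0 <= rho -> 0 < rho' -> 0 <= c -> dense rho d G ->
  rho ^+ 2 <= (1 - a) * (a * d) ^+ (k + k) ->
  rho ^+ 2 <= (1 - a) * (rho' * ((a * d) ^+ k) ^+ r) ^+ 2 ->
  (forall G' : sgraph, (N <= #|G'|)%N -> dense rho' (a * (a * d)) G' ->
     c <= hom_density R H G') ->
  c * (#|G|%:R * ((a * d * #|G|%:R) ^+ k) ^+ r) ^+ #|H|
  <= (\sum_(x : {ffun H -> G}) \prod_(p : oedge H)
        walks (k + k).+1 (x (val p).1) (x (val p).2))%:R.
Proof.
move=> hr r0 G0 /andP[d0 d1] /andP[a0 a1] rho0 rho'0 c0 dG rk rr hN.
have n0 : 0 < #|G|%:R :> R by rewrite ltr0n.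
pose w (x : G) := nwalks k x.
have [M M0 [psi0 psi0E]] := common_sample_space (@walks G k).
pose l (x t : G) : R := #|[set q | psi0 x q == t]|%:R / #|'I_M|%:R.
have lE x t : (w x)%:R * l x t = (walks k x t)%:R.
  rewrite /l card_ord; have [w0|wx] := posnP (w x).
    rewrite w0 mul0r; move/eqP: w0; rewrite /w /nwalks sum_nat_eq0.
    by move=> /forallP/(_ t)/eqP->.
  rewrite mulrA -natrM mulnC (psi0E _ _ wx) natrM mulrC mulKf //.
  by rewrite pnatr_eq0 -lt0n.
pose V : finType := {x : G & 'I_(w x ^ r)}.
pose psi (v : V) := psi0 (tag v).
have lawl (v : V) t : law psi R v t = l (tag v) t by [].
have nr : #|G|%:R * ((a * d * #|G|%:R) ^+ k) ^+ r <= #|V|%:R.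
  have -> : #|V|%:R = \sum_x (w x)%:R ^+ r :> R.
    rewrite -sumr_const (sum_tagged_ord (fun x => w x ^ r)%N (fun _ => 1)).
    by apply: eq_bigr => x _; rewrite mulr1 natrX.
  apply: power_mean => //; first by rewrite exprn_ge0 // !mulr_ge0 ?ltW.
  rewrite -natr_sum; apply: (dense_nwalks (rho := rho)) => //; first by rewrite d0.
  by rewrite a0 ltW.
have nr0 : 0 < #|G|%:R * ((a * d * #|G|%:R) ^+ k) ^+ r.
  by rewrite mulr_gt0 // !exprn_gt0 // !mulr_gt0.
have V0 : (0 < #|V|)%N by rewrite -(ltr0n R); apply: lt_le_trans nr.
have Q0 : (0 < #|'I_M|)%N by rewrite card_ord.
pose B : R := (#|G|%:R ^+ k) ^+ r.
have B0 : 0 < B by rewrite !exprn_gt0.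
have sum_lawB t : \sum_v law psi R v t <= B.
  rewrite (sum_tagged_ord (fun x => w x ^ r)%N (fun x => l x t)).
  have wk (x : G) : (w x)%:R <= #|G|%:R ^+ k :> R by rewrite -natrX ler_nat nwalks_le.
  (* One factor [w x], available as [r] is positive, turns the law into a count of walks; the other
     [r.-1] factors are bounded by [#|G| ^ k]. *)
  apply: (@le_trans _ _ (\sum_x (#|G|%:R ^+ k) ^+ r.-1 * (walks k t x)%:R)).
    apply: ler_sum => x _; rewrite natrX -{1}(prednK r0) exprSr -mulrA lE walks_sym.
    by rewrite ler_wpM2r // lerXn2r ?nnegrE ?exprn_ge0.
  rewrite -mulr_sumr -natr_sum /B -{2}(prednK r0) exprSr.
  by rewrite ler_wpM2l ?wk // !exprn_ge0.
have dK (F : V -> R) : (forall v, 0 <= F v <= 1) ->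
    rho' * #|V|%:R <= \sum_v F v ->
    a * d * (\sum_v F v) ^+ 2 <= \sum_v \sum_v' F v * F v' * kernel psi R v v'.
  move=> F01 rF; rewrite -edge_form_combination.
  pose f t := \sum_v F v * law psi R v t.
  have fB t : 0 <= f t <= B.
    apply/andP; split.
      by rewrite sumr_ge0 // => v _; have /andP[? _] := F01 v; rewrite mulr_ge0 ?law_ge0.
    apply: le_trans (sum_lawB t); apply: ler_sum => v _.
    by have /andP[_ ?] := F01 v; rewrite ler_piMl ?law_ge0.
  have sumf : \sum_t f t = \sum_v F v.
    rewrite exchange_big; apply: eq_bigr => v _.
    by rewrite -mulr_sumr sum_law ?mulr1.
  apply: le_trans (dense_edge_form_scaled (ltW d0) B0 dG fB); rewrite sumf.
  (* The error of local density takes at most a fraction [1 - a] of the main term, which leaves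
     density [a * d] for the kernel. *)
  have bnd : (rho * #|G|%:R * B) ^+ 2 <= (1 - a) * (\sum_v F v) ^+ 2.
    rewrite -mulrA exprMn; apply: le_trans (ler_wpM2r (sqr_ge0 _) rr) _.
    rewrite -mulrA ler_wpM2l ?subr_ge0 ?(ltW a1) // -exprMn.
    have E : rho' * ((a * d) ^+ k) ^+ r * (#|G|%:R * B)
        = rho' * (#|G|%:R * ((a * d * #|G|%:R) ^+ k) ^+ r).
      by rewrite /B !exprMn; ring.
    have le : rho' * ((a * d) ^+ k) ^+ r * (#|G|%:R * B) <= \sum_v F v.
      by rewrite E; apply: le_trans rF; rewrite ler_wpM2l ?(ltW rho'0).
    have ge : 0 <= rho' * ((a * d) ^+ k) ^+ r * (#|G|%:R * B).
      by rewrite E mulr_ge0 ?(ltW rho'0) ?(ltW nr0).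
    by rewrite lerXn2r ?nnegrE // (le_trans ge).
  have := ler_wpM2l (ltW d0) bnd; lra.
have ad : a * (a * d) < a * d by rewrite gtr_pMl // mulr_gt0.
have := KNRS_kernel V0 Q0 rho'0 ad hN dK.
pose kap x y : R := edge_form (l x) (l y).
pose Phi (x : {ffun H -> G}) := \prod_(p : oedge H) kap (x (val p).1) (x (val p).2).
rewrite (eq_bigr (fun v : {ffun H -> V} => Phi [ffun u => tag (v u)])); last first.
  by move=> v _; apply: eq_bigr => p _; rewrite !ffunE.
rewrite (sum_ffun_tagged_ord (fun x => w x ^ r)%N Phi).
(* A walk of length [2k + 1] is two [k]-walks joined by its middle edge. *)
have kapE x y : (w x)%:R * (w y)%:R * kap x y = (walks (k + k).+1 x y)%:R.
  rewrite -edge_formZ (eq_edge_form (lE x) (lE y)) -addnS walks_add natr_sum.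
  apply: eq_bigr => s _; rewrite natrM walksS natr_sum mulr_sumr.
  by apply: eq_bigr => t _; rewrite natrM [walks k t y]walks_sym; ring.
rewrite natr_sum (eq_bigr (fun x : {ffun H -> G} => (\prod_(p : oedge H)
  walks (k + k).+1 (x (val p).1) (x (val p).2))%:R)) => [h|x _]; last first.
  under eq_bigr do rewrite natrX.
  rewrite -(prod_oedge_regular (fun u => (w (x u))%:R) hr) -big_split natr_prod /=.
  by apply: eq_bigr => p _; rewrite kapE.
apply: le_trans h; rewrite ler_wpM2l // lerXn2r ?nnegrE ?(ltW nr0) //.
Qed.

Theorem theorem1p6 (R : realType) (k : nat) (hk : (1 <= k)%N) (H : sgraph)
  (hK : KNRS R H) (hreg : regular H) : KNRS R (subdivision (2 * k)%N H).
Proof.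
move=> d eps d0 eps0.
pose e := #|oedge H|.
have hom_ge0 G : 0 <= hom_density R (subdivision (2 * k) H) G.
  by rewrite divr_ge0.
have [eps1|eps1] := leP 1 eps.
  exists 1 => //; exists 0%N => G _ _; apply: le_trans (hom_ge0 G).
  by rewrite mulr_le0_ge0 ?exprn_ge0 ?(ltW d0) // subr_le0.
(* Without edges the density is 1, while [d <= 1] keeps the bound below 1. *)
have [e0|e0] := posnP e.
  exists 1 => //; exists 1%N => G G0 dG; have d1 := dense_le1 (lexx 1) G0 dG.
  apply: (@le_trans _ _ 1).
    by rewrite mulr_ile1 ?subr_ge0 ?(ltW eps1) ?exprn_ge0 ?exprn_ile1 ?(ltW d0) ?gerBl ?(ltW eps0).
  rewrite /hom_density card_hom_subdivision card_ffun card_subdivision -/e e0.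
  rewrite mul0n addn0 (eq_bigr (fun _ => 1%N)) => [|x _]; last first.
    by rewrite big_pred0 // => p; have := card0_eq e0 p.
  by rewrite sum1_card card_ffun divff // pnatr_eq0 expn_eq0 -leqn0 leqNgt G0.
have [r hr] := hreg.
have r0 : (0 < r)%N.
  have /card_gt0P[p _] := e0; have /andP[pa _] := valP p.
  by rewrite -(hr (val p).1); apply/card_gt0P; exists (val p).2; rewrite inE.
(* [L.+1] counts the factors [a] lost in the end: one as the KNRS error for [H], [2e] from the
   density [a * (a * d)], and [2ke] from the number of walks. By Bernoulli's inequality their
   product is at least [1 - eps]. *)
pose L := (e + e + k * e + k * e)%N.
pose a : R := 1 - eps / L.+1%:R.
have L0 : 0 < L.+1%:R :> R by rewrite ltr0n.
have epsL : 0 < eps / L.+1%:R < 1.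
  rewrite divr_gt0 //= ltr_pdivrMr // mul1r; apply: lt_le_trans eps1 _.
  by rewrite ler1n.
have /andP[a0 a1] : 0 < a < 1.
  by case/andP: epsL => ? ?; rewrite /a subr_gt0 gtrBl; apply/andP.
have aL : 1 - eps <= a ^+ L.+1.
  have := exprn_tangent_le L ler01 (ltW a0); rewrite !expr1n.
  have -> : 1 + L.+1%:R * 1 * (a - 1) = 1 - eps.
    by rewrite mulr1 /a [1 - _ - 1]addrAC subrr add0r mulrN mulrC divfK ?gt_eqF.
  by [].
have aad0 : 0 < a * (a * d) by rewrite !mulr_gt0.
have ad0 : 0 < a * d by rewrite mulr_gt0.
have eps'0 : 0 < 1 - a by rewrite subr_gt0.
have [rho' rho'0 [N hN]] := hK (a * (a * d)) (1 - a) aad0 eps'0.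
pose x1 := (1 - a) * (a * d) ^+ k.
pose x2 := (1 - a) * (rho' * ((a * d) ^+ k) ^+ r).
have x10 : 0 < x1 by rewrite mulr_gt0 ?subr_gt0 ?exprn_gt0.
have x20 : 0 < x2 by rewrite !mulr_gt0 ?subr_gt0 ?exprn_gt0.
pose rho := Num.min 1 (Num.min x1 x2).
have rho0 : 0 < rho by rewrite !lt_min ltr01 x10 x20.
have [rho1 rhox1 rhox2] : [/\ rho <= 1, rho <= x1 & rho <= x2].
  by rewrite /rho !ge_min !lexx !orbT.
(* Squaring gives [(1 - a) ^+ 2], which is at most [1 - a]. *)
have sq (x : R) : 0 < x -> rho <= (1 - a) * x -> rho ^+ 2 <= (1 - a) * x ^+ 2.
  move=> x0 rx; apply: (@le_trans _ _ (((1 - a) * x) ^+ 2)).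
    by rewrite lerXn2r ?nnegrE ?mulr_ge0 ?subr_ge0 ?(ltW rho0) ?(ltW a1) ?(ltW x0).
  rewrite exprMn ler_wpM2r ?sqr_ge0 // expr2 ler_piMl ?subr_ge0 ?(ltW a1) //.
  by rewrite gerBl ltW.
(* It suffices that [G] is nonempty: the large graphs required by the KNRS property of [H] are the
   blow-ups. *)
exists rho => //; exists 1%N => G G0 dG.
have d1 := dense_le1 rho1 G0 dG.
have n0 : 0 < #|G|%:R :> R by rewrite ltr0n.
have d01 : 0 < d <= 1 by rewrite d0.
have a01 : 0 < a < 1 by rewrite a0.
have sq1 : rho ^+ 2 <= (1 - a) * (a * d) ^+ (k + k).
  by rewrite addnn -mul2n mulnC exprM; apply: sq => //; rewrite exprn_gt0.
have sq2 : rho ^+ 2 <= (1 - a) * (rho' * ((a * d) ^+ k) ^+ r) ^+ 2.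
  by apply: sq => //; rewrite mulr_gt0 ?exprn_gt0.
have c0 : 0 <= (1 - (1 - a)) * (a * (a * d)) ^+ #|edges H|.
  by rewrite subKr mulr_ge0 ?exprn_ge0 ?ltW.
have := sum_walks_ge hr r0 G0 d01 a01 (ltW rho0) rho'0 c0 dG sq1 sq2 hN.
rewrite subKr /hom_density card_hom_subdivision card_ffun card_subdivision.
rewrite -/e -card_oedge -/e addnn -mul2n.
set S := (\sum_x _)%:R => hS.
rewrite ler_pdivlMr ?ltr0n ?expn_gt0 ?G0 //; apply: le_trans hS.
(* Constant weights give the handshake identity [r * #|H| = 2e] in exponents. *)
have CE (C : R) : (C ^+ r) ^+ #|H| = C ^+ e * C ^+ e.
  have := prod_oedge_regular (fun _ => C) hr; rewrite !prodr_const => <-.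
  by rewrite -exprMn.
rewrite [(#|G|%:R * _) ^+ _]exprMn CE natrX exprD.
have -> : a * (a * (a * d)) ^+ e * (#|G|%:R ^+ #|H| * (((a * d * #|G|%:R) ^+ k) ^+ e *
    ((a * d * #|G|%:R) ^+ k) ^+ e))
  = a ^+ L.+1 * d ^+ (e * (2 * k).+1) * (#|G|%:R ^+ #|H| * #|G|%:R ^+ (e * (2 * k))).
  have ek : (e * (2 * k) = k * e + k * e)%N by rewrite mulnCA mul2n -addnn mulnC.
  rewrite mulnS ek.
  rewrite /L exprS !exprD -!exprM !exprMn.
  move: (a ^+ e) (d ^+ e) (a ^+ (k * e)) (d ^+ (k * e)) (#|G|%:R ^+ (k * e)).
  by move: (#|G|%:R ^+ #|H|) => *; ring.
rewrite ler_wpM2r ?mulr_ge0 ?exprn_ge0 //.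
apply: ler_pM => //; first by rewrite subr_ge0 ltW.
  by rewrite exprn_ge0 // ltW.
by rewrite ler_wiXn2l ?(ltW d0) // card_edges_subdivision // muln_gt0.
Qed.
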